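(* Let $r\ge 1$ and $n\geq 4r^2$ be integers and let $G\in\{\mathrm{A}_{n,r},\mathrm{S}_{n,r}\}$. Then $\mathcal{G}(G)\leq \frac{17}{10}\, b(G)$.
   Context: $\mathrm{S}_{n,r}$ and $\mathrm{A}_{n,r}$ denote $\mathrm{S}_n$ and $\mathrm{A}_n$ acting naturally on the set $\binom{[n]}{r}$ of $r$-subsets of $[n]=\{1,\dots,n\}$. For a finite permutation group $G$ on $\Omega$, $b(G)$ is the minimum size of a subset of $\Omega$ with trivial pointwise stabiliser. The greedy algorithm builds $\beta_1,\beta_2,\dots$ where each $\beta_i$ lies in a largest orbit of the pointwise stabiliser of $\{\beta_1,\dots,\beta_{i-1}\}$, stopping when this stabiliser is trivial; $\mathcal{G}(G)$ is the maximum size of a base produced this way over all choices. *)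

(* Defs.v *)
From mathcomp Require Import all_boot all_fingroup all_solvable.
Set Implicit Arguments. Unset Strict Implicit. Unset Printing Implicit Defensive.
Local Open Scope group_scope.

(* Omega = the r-subsets of [n] = 'I_n; the group acts via the natural
   induced action 'P^* of {perm 'I_n} on {set 'I_n}. *)
Definition rsubsets (n r : nat) : {set {set 'I_n}} := [set A : {set 'I_n} | #|A| == r].

(* pointwise stabiliser in G of a set S of r-subsets *)
Definition pstab n (G : {set {perm 'I_n}}) (S : {set {set 'I_n}}) :=
  'C_G(S | ('P^*)%act).

(* B is a base of G acting on r-subsets *)
Definition is_base n r (G : {set {perm 'I_n}}) (B : {set {set 'I_n}}) : bool :=
  (B \subset rsubsets n r) && (pstab G B == 1).

(* b(G): minimal size of a base (default value #|Omega| is never smaller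
   than the true minimum, since Omega is itself a base when the action is
   faithful, which is the case here as r < n) *)
Definition base_size n r (G : {set {perm 'I_n}}) : nat :=
  \big[minn/#|rsubsets n r|]_(B in powerset (rsubsets n r) | is_base r G B) #|B|.

(* s = [:: beta_1; ...; beta_k] is a base produced by the greedy algorithm *)
Definition greedy_base n r (G : {set {perm 'I_n}}) (s : seq {set 'I_n}) : bool :=
  [forall i : 'I_(size s),
     let H := pstab G [set x in take i s] in
     let beta := nth set0 s i in
     [&& H != 1, beta \in rsubsets n r &
         [forall gamma in rsubsets n r,
            #|orbit ('P^*)%act H gamma| <= #|orbit ('P^*)%act H beta|]]]
  && (pstab G [set x in s] == 1).

(* calG(G): maximal length of a greedy base (a greedy base has pairwise
   distinct points, so its length is at most #|Omega|) *)
Definition greedy_max n r (G : {set {perm 'I_n}}) : nat :=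
  \max_(k < #|rsubsets n r|.+1
          | [exists s : k.-tuple {set 'I_n}, greedy_base r G s]) k.

(* Main.v *)
Require Import Defs.
From mathcomp Require Import all_boot all_fingroup all_solvable.
From mathcomp Require Import zify.
Set Implicit Arguments. Unset Strict Implicit. Unset Printing Implicit Defensive.

(** A set of [r]-subsets cuts ['I_n] into cells, two points sharing a cell when
    they lie in the same subsets; its stabiliser in the symmetric group is the
    product of the symmetric groups of the cells.

    Lower bound on [b(G)]: all points of ['I_n] but one lie in distinct cells of
    a base [B], so at most one of them lies in no member of [B] and at most [#|B|]
    in just one; counting incidences gives [2 (n - 2) <= #|B| (r + 1)].

    Upper bound on the greedy algorithm: if a step takes [x i] of the [a i] points
    of cell [i] and does not end the algorithm, moving one point from cell [i] to
    cell [j] does not enlarge the orbit, i.e.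
    [x i * (a j - x j) <= (x j + 1) * (a i - x i + 1)]. While the core (the cell of
    points not yet used) has at least [r^2 + r] points, this forces a step to take
    all its points there, which leaves [m >= 3 r] blocks of size [r] and a core of
    [u < r^2 + r] points. After that the blocks shrink in a balanced way, one point
    at a time, while the core shrinks faster than the square of the block size;
    so all steps but a bounded number lower the potential [sum (a i - 1) + u]
    by [r]. *)

(** * The sizes of the cells along a greedy run *)

Definition exchange (I : finType) (a x : I -> nat) :=
  forall i j, i != j -> x i * (a j - x j) <= (x j).+1 * (a i - x i).+1.

(** The Boolean tells whether the piece lies inside the chosen subset, so the label type grows with
    each step. *)
Definition split_cells (I : finType) (a x : I -> nat) (ib : I * bool) :=
  if ib.2 then x ib.1 else a ib.1 - x ib.1.

(* [run r k a]: from cells of sizes [a], [k] greedy steps are possible, none of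
   which separates all points. *)
Fixpoint run (r k : nat) (I : finType) (a : I -> nat) : Prop :=
  if k is k'.+1 then
    exists x : I -> nat,
      [/\ forall i, x i <= a i, \sum_i x i = r, exchange a x,
          exists ib, 1 < split_cells a x ib
        & run r k' (split_cells a x)]
  else True.

Lemma eq_run r k (I : finType) (a b : I -> nat) : a =1 b -> run r k a -> run r k b.
Proof.
elim: k I a b => //= k IHk I a b eq_ab [x [le_xa sum_x ex [ib nt] runx]].
have eq_sp : split_cells a x =1 split_cells b x.
  by case=> i c; rewrite /split_cells /= eq_ab.
exists x; split=> //.
- by move=> i; rewrite -eq_ab.
- by move=> i j ne; rewrite -!eq_ab ex.
- by exists ib; rewrite -eq_sp.
exact: IHk runx.
Qed.

(** * Consequences of the exchange inequality for one step *)

Section Step.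

Variables (r : nat) (I : finType) (a x : I -> nat).
Hypothesis le_xa : forall i, x i <= a i.
Hypothesis ex : exchange a x.

Lemma sum_split_cells (F : nat -> nat) :
  \sum_ib F (split_cells a x ib) = \sum_i (F (x i) + F (a i - x i)).
Proof.
rewrite -(pair_bigA _ (fun i b => F (split_cells a x (i, b)))) /=.
by apply: eq_bigr => i _; rewrite big_bool.
Qed.

Lemma sum_split_cells_id : \sum_ib split_cells a x ib = \sum_i a i.
Proof. by rewrite (sum_split_cells id); apply: eq_bigr => i _; rewrite subnKC. Qed.

(** If [3 * x i >= a i + 2], then [a i - x i + 1 < 2 * x i]; cancelling [x i] in the exchange
    inequality leaves [a j - x j < 2 * (x j + 1)]. *)
Lemma exchange_dichotomy :
  (forall i, 0 < x i -> 3 * x i <= (a i).+1) \/ (forall j, a j <= (3 * x j).+1).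
Proof.
have [/forallP good | ] := boolP [forall i, (0 < x i) ==> (3 * x i <= (a i).+1)].
  by left=> i; apply/implyP.
rewrite negb_forall => /existsP[i]; rewrite negb_imply -ltnNge => /andP[xi_gt0 big_xi].
right=> j; have [->|ne_ij] := eqVneq j i; first by lia.
have := ex (_ : i != j); rewrite eq_sym ne_ij => /(_ isT); have := le_xa i; have := le_xa j.
by nia.
Qed.

(** An excess at [i] would by exchange force [a j <= 2 * x j] everywhere, and the total would be at
    most [2 * r]. *)
Lemma exchange_half : \sum_i x i = r -> 2 * r < \sum_i a i -> forall i, 2 * x i <= (a i).+1.
Proof.
move=> sum_x big_n i.
have [/existsP[j lt_j] | ] := boolP [exists j, 2 * x j < a j].
  have [<-|ne_ij] := eqVneq j i; first by lia.
  have := ex (_ : i != j); rewrite eq_sym ne_ij => /(_ isT); have := le_xa i; have := le_xa j.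
  by nia.
rewrite negb_exists => /forallP all_small; move: big_n; rewrite -sum_x big_distrr /=.
rewrite ltnNge leq_sum // => j _; have := all_small j; by rewrite -leqNgt.
Qed.

End Step.

(** Every step properly splits some cell, so the sum drops by at least one; it is still positive at
    the end. *)
Lemma run_trivial_bound r k (I : finType) (a : I -> nat) :
  0 < r -> 2 * r < \sum_i a i -> (exists i, 1 < a i) -> run r k a ->
  k < \sum_i (a i).-1.
Proof.
move=> r_gt0; elim: k I a => [|k IHk] I a big_n [i0 nt0].
  by rewrite (bigD1 i0) //=; lia.
move=> [x [le_xa sum_x ex nt' runx]].
have half := exchange_half le_xa ex sum_x big_n.
have := IHk _ _ _ nt' runx; rewrite sum_split_cells_id // => /(_ big_n).
rewrite (sum_split_cells a x predn) => lt_k.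
suff [j /andP[xj_gt0 lt_j]] : exists j, 0 < x j < a j.
  apply: leq_ltn_trans lt_k _.
  rewrite (bigD1 j) //= [ltnRHS](bigD1 j) //= -addSn leq_add //; first by lia.
  by apply: leq_sum => i _; have := le_xa i; lia.
(* If [i0] is missed, a hit cell [j] cannot be taken whole: exchange would give
   [a j * a i0 <= 1]. *)
have [xi0 | ] := posnP (x i0); last first.
  by move=> xi_gt0; exists i0; rewrite xi_gt0; have := half i0; lia.
have [j xj_gt0] : exists j, 0 < x j.
  apply/existsP; rewrite -[[exists _, _]]negbK negb_exists; apply/negP => /forallP x0.
  by move: r_gt0; rewrite -sum_x big1 // => i _; have := x0 i; lia.
exists j; rewrite xj_gt0 ltn_neqAle le_xa andbT; apply/negP => /eqP eq_j.
have ne : j != i0 by apply/eqP => eq_ji; move: xj_gt0; rewrite eq_ji xi0.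
by have := ex _ _ ne; rewrite xi0 eq_j; nia.
Qed.

(** * Runs through cells of bounded size *)

(* A point of a cell of size at most 4, 13 or 40 can be taken at most 1, 2 or 3
   times in steps that take at most a third ([3 x <= a + 1]) of every cell. *)
Definition split_cost a := if a <= 4 then a.-1 else if a <= 13 then 2 * a else 3 * a.

(* [(2 c + 1) / 3] is at most [size_cap b] when [c <= size_cap b.+1]: a step that
   takes more than a third of some cell takes about a third of every cell. *)
Definition size_cap b := nth 0 [:: 2; 3; 4; 6; 9; 13; 20] b.

Lemma split_cost_split a x : x <= a -> split_cost x + split_cost (a - x) <= split_cost a.
Proof. rewrite /split_cost => le.
by case: (leqP x 4); case: (leqP x 13); case: (leqP (a - x) 4); case: (leqP (a - x) 13);
  case: (leqP a 4); case: (leqP a 13); lia. Qed.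

(** A third of a cell of size at most 4, 13 or 40 has at most 1, 4 or 13 points, so the piece taken
    falls into a cheaper tier and saves at least one per point. *)
Lemma split_cost_split_third a x : a <= 40 -> 0 < x -> 3 * x <= a.+1 ->
  x + (split_cost x + split_cost (a - x)) <= split_cost a.
Proof. rewrite /split_cost => *.
by case: (leqP x 4); case: (leqP x 13); case: (leqP (a - x) 4); case: (leqP (a - x) 13);
  case: (leqP a 4); case: (leqP a 13); lia. Qed.

(** A step taking at most about a third of each cell it hits lowers the total cost by [r]; any other
    step lowers the cap index [b] and is paid for by one [r] of [b * r]. *)
Lemma run_small r k b (I : finType) (a : I -> nat) :
  2 * r < \sum_i a i -> b <= 6 -> (forall i, a i <= size_cap b) -> run r k a ->
  r * k <= \sum_i split_cost (a i) + b * r.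
Proof.
elim: k b I a => [|k IHk] b I a big_n le_b6 le_a; first by rewrite muln0.
move=> [x [le_xa sum_x ex nt' runx]].
have half := exchange_half le_xa ex sum_x big_n.
have le20 : size_cap b <= 20 by case: b le_b6 {le_a} => [|[|[|[|[|[|[|b]]]]]]].
have [good | bad] := exchange_dichotomy le_xa ex.
  have le_a' ib : split_cells a x ib <= size_cap b.
    by rewrite /split_cells; have := le_a ib.1; have := le_xa ib.1; case: ifP => _; lia.
  have := IHk b _ _ _ le_b6 le_a' runx; rewrite sum_split_cells_id // => /(_ big_n).
  rewrite (sum_split_cells a x split_cost) => le_k.
  suff : r + \sum_i (split_cost (x i) + split_cost (a i - x i)) <= \sum_i split_cost (a i) by lia.
  rewrite -sum_x -big_split /=; apply: leq_sum => i _.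
  have [->|xi_gt0] := posnP (x i); first by rewrite subn0 !add0n.
  by apply: split_cost_split_third (good i xi_gt0) => //; have := le_a i; lia.
have shrink i : split_cells a x i <= (2 * a i.1).+1 %/ 3 \/ a i.1 = 0.
  have := bad i.1; have := half i.1; have := le_xa i.1; rewrite /split_cells.
  by case: ifP => _; lia.
case: b => [|b] in le_b6 le_a le20 *.
  (* Under the lowest cap, 2, such a step would leave pieces of size at most 1, against [nt']. *)
  by case: nt' => ib; have := shrink ib; have := le_a ib.1; rewrite /size_cap /=; 
    have := le_xa ib.1; rewrite /split_cells; case: ifP => _; lia.
have le_a' ib : split_cells a x ib <= size_cap b.
  have := shrink ib; have := le_a ib.1; have := le_xa ib.1; rewrite /split_cells.
  move=> le_x le_t sh.
  have : (2 * size_cap b.+1).+1 %/ 3 <= size_cap b.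
    by case: b le_b6 {le_t le_a le20} => [|[|[|[|[|[|b]]]]]].
  by case: ifP sh => _; lia.
have := IHk b _ _ _ (ltnW le_b6) le_a' runx; rewrite sum_split_cells_id // => /(_ big_n).
rewrite (sum_split_cells a x split_cost) => le_k.
suff : \sum_i (split_cost (x i) + split_cost (a i - x i)) <= \sum_i split_cost (a i).
  by rewrite mulnS mulSn; lia.
by apply: leq_sum => i _; apply: split_cost_split.
Qed.

(** * The core against the mean block size *)

(* [U <= y^2 + y + 5/3] for the mean size [y = P / N] of [N] blocks; the constants
   make this stable under a greedy step as long as the blocks have size at least 4. *)
Definition core_bound (N P U : nat) := 3 * N ^ 2 * U <= 3 * P ^ 2 + 3 * P * N + 5 * N ^ 2.

Lemma core_bound_full N P U mu : 0 < N -> core_bound N P U -> P <= N * mu ->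
  U <= mu ^ 2 + mu + 1.
Proof.
rewrite /core_bound => N_gt0 bd leP.
have : 3 * N ^ 2 * U <= N ^ 2 * (3 * mu ^ 2 + 3 * mu + 5).
  apply: leq_trans bd _; have : P ^ 2 <= (N * mu) ^ 2 by rewrite leq_exp2r.
  have : P * N <= N * mu * N by rewrite leq_mul2r leP orbT.
  by rewrite !expnS !expn0; lia.
rewrite mulnAC [leqLHS]mulnC leq_pmul2l ?expn_gt0 ?N_gt0 //.
by lia.
Qed.

(** At mean size [mu - 2/3] the bound reads [mu ^ 2 - mu / 3 + 13 / 9], which is below [mu ^ 2] once
    [mu >= 5]. *)
Lemma core_bound_third N P U mu : 0 < N -> core_bound N P U -> 4 < mu ->
  3 * P + 2 * N <= 3 * N * mu -> U < mu ^ 2.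
Proof.
rewrite /core_bound => N_gt0 bd mu_gt4 leP.
have bd2 : N ^ 2 * (27 * U) <= N ^ 2 * (27 * mu ^ 2 - 9 * mu + 39).
  have -> : 27 * mu ^ 2 - 9 * mu = 9 * mu * (3 * mu - 1) by rewrite mulnBr; lia.
  have -> : 9 * mu * (3 * mu - 1) + 39 = 3 * (3 * mu - 2) ^ 2 + 9 * (3 * mu - 2) + 45.
    by case: mu mu_gt4 {leP} => [|mu] // _; rewrite !expnS !expn0; lia.
  have leP' : 3 * P <= N * (3 * mu - 2) by lia.
  have : (3 * P) ^ 2 <= (N * (3 * mu - 2)) ^ 2 by rewrite leq_exp2r.
  have : 3 * P * N <= N * (3 * mu - 2) * N by rewrite leq_mul2r leP' orbT.
  by move: bd; set v := 3 * mu - 2; rewrite !expnS !expn0; lia.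
move: bd2; rewrite leq_pmul2l ?expn_gt0 ?N_gt0 //; nia.
Qed.

(** Exchange with a hit block of size [s] gives [U <= (x + 1) * (s + 1)]: the core shrinks by the
    factor [s / (s + 1)] up to 1, while the mean falls by at most [1 / 3]. *)
Lemma core_bound_step N P Q U x s :
  core_bound N P U -> U <= x.+1 * s.+1 -> 3 * P <= 3 * Q + N ->
  s * N <= Q + N -> 4 * N <= Q -> core_bound N Q (U - x).
Proof.
rewrite /core_bound => bd leU leP les leQ.
rewrite -(leq_pmul2l (ltn0Sn s)).
have h1 : s.+1 * (U - x) <= s * U + s.+1 by rewrite mulnBr; nia.
have h2 : 9 * P ^ 2 <= 9 * Q ^ 2 + 6 * Q * N + N ^ 2.
  have : (3 * P) ^ 2 <= (3 * Q + N) ^ 2 by rewrite leq_exp2r.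
  by rewrite !expnS !expn0; lia.
have h3 : 3 * P * N <= (3 * Q + N) * N by rewrite leq_mul2r leP orbT.
have h4 : 3 * (3 * N ^ 2 * U) <= 9 * Q ^ 2 + 15 * Q * N + 19 * N ^ 2.
  by move: bd h2 h3; rewrite !expnS !expn0; lia.
have h5 : s * (6 * Q * N + 13 * N ^ 2) <= (Q + N) * (6 * Q + 13 * N).
  have -> : s * (6 * Q * N + 13 * N ^ 2) = (s * N) * (6 * Q + 13 * N).
    by rewrite !expnS !expn0; lia.
  by rewrite leq_mul2r les orbT.
have h6 : 10 * Q * N + 7 * N ^ 2 <= 3 * Q ^ 2 by rewrite !expnS !expn0; nia.
have h7 : s * (3 * (3 * N ^ 2 * U)) <= s * (9 * Q ^ 2 + 15 * Q * N + 19 * N ^ 2).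
  by rewrite leq_mul2l h4 orbT.
have h8 : 9 * N ^ 2 * (s.+1 * (U - x)) <= 9 * N ^ 2 * (s * U + s.+1).
  by rewrite leq_mul2l h1 orbT.
move: h5 h6 h7 h8; rewrite !expnS !expn0; lia.
Qed.

(** This variant asks for mean size 4 only before the step, at the price of [s] being at most the
    old mean. *)
Lemma core_bound_step_low N P Q U x s :
  core_bound N P U -> U <= x.+1 * s.+1 -> 3 * P <= 3 * Q + N ->
  s * N <= P -> 4 * N <= P -> core_bound N Q (U - x).
Proof.
rewrite /core_bound => bd leU leP les leQ.
rewrite -(leq_pmul2l (ltn0Sn s)).
have h1 : s.+1 * (U - x) <= s * U + s.+1 by rewrite mulnBr; nia.
have h2 : 9 * P ^ 2 + N ^ 2 <= 9 * Q ^ 2 + 6 * P * N.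
  have : (3 * P - N) ^ 2 <= (3 * Q) ^ 2 by rewrite leq_exp2r; lia.
  have -> : 9 * P ^ 2 = (3 * P) ^ 2 by rewrite expnMn.
  have -> : 6 * P * N = 2 * (3 * P) * N by lia.
  have : N <= 3 * P by lia.
  move: (3 * P) => p /subnK <-; rewrite addnK => le; move: le.
  by rewrite !expnS !expn0; lia.
have h3 : 3 * P * N <= (3 * Q + N) * N by rewrite leq_mul2r leP orbT.
have h5 : s * (6 * P * N + 11 * N ^ 2) <= P * (6 * P + 11 * N).
  have -> : s * (6 * P * N + 11 * N ^ 2) = (s * N) * (6 * P + 11 * N).
    by rewrite !expnS !expn0; lia.
  by rewrite leq_mul2r les orbT.
have h6 : 8 * P * N <= 3 * P ^ 2 + 4 * N ^ 2 by rewrite !expnS !expn0; nia.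
have h7 : s * (3 * N ^ 2 * U) <= s * (3 * P ^ 2 + 3 * P * N + 5 * N ^ 2).
  by rewrite leq_mul2l bd orbT.
have h8 : 9 * N ^ 2 * (s.+1 * (U - x)) <= 9 * N ^ 2 * (s * U + s.+1).
  by rewrite leq_mul2l h1 orbT.
have h9 : s.+1 * (9 * P ^ 2 + 3 * P * N + 13 * N ^ 2)
          <= s.+1 * (9 * Q ^ 2 + 9 * Q * N + 15 * N ^ 2).
  by rewrite leq_mul2l; apply/orP; right; move: h2 h3; rewrite !expnS !expn0; lia.
move: h5 h6 h7 h8 h9; rewrite !expnS !expn0; lia.
Qed.

(** * The balanced phase *)

(** With [3 * r] tracked blocks in [J], a step of [r] points misses one of them and lowers their
    mean by at most [1 / 3]. Comparison with the missed block limits every other cell except the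
    core to one point. *)
Lemma run_balanced r k (I : finType) (a : I -> nat) z (J : {set I}) mu :
  0 < r -> 2 * r < \sum_i a i -> #|J| = 3 * r -> z \notin J -> 3 < mu ->
  (forall i, i != z -> a i <= mu) -> (forall j, j \in J -> mu.-1 <= a j) ->
  core_bound (3 * r) (\sum_(j in J) a j) (a z).+1 -> run r k a ->
  r * k <= \sum_i (a i).-1 + a z + 21 + 6 * r.
Proof.
move=> r_gt0; elim: k I a z J mu => [|k IHk] I a z J mu big_n cardJ zJ mu_gt3 le_mu ge_mu bd.
  by rewrite muln0.
have leP : \sum_(j in J) a j <= 3 * r * mu.
  rewrite -cardJ -sum_nat_const; apply: leq_sum => j Jj; apply: le_mu.
  by apply: contraNneq zJ => <-.
have N_gt0 : 0 < 3 * r by rewrite muln_gt0.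
(* At [mu = 4] the core has at most 20 points and [run_small] with cap index 6 finishes, hence
   [6 * r]. The 21 covers the cost of the core: [3 * 20 = 19 + 20 + 21]. *)
have [mu4 | mu_gt4] := leqP mu 4.
  have {mu_gt3 mu4} eq_mu : mu = 4 by lia.
  move: eq_mu le_mu leP => -> {ge_mu mu} le_mu leP.
  have le_z : a z <= 20.
    by have := core_bound_full N_gt0 bd leP; rewrite !expnS expn0; lia.
  move=> runa; have le20 i : a i <= size_cap 6.
    by have [->|/le_mu] := eqVneq i z; rewrite /size_cap //=; lia.
  have := run_small big_n (leqnn 6) le20 runa.
  rewrite (bigD1 z) //= [\sum_i _.-1](bigD1 z) //=.
  have -> : \sum_(i | i != z) split_cost (a i) = \sum_(i | i != z) (a i).-1.
    by apply: eq_bigr => i /le_mu le4; rewrite /split_cost le4.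
  by rewrite /split_cost; case: (leqP (a z) 4); case: (leqP (a z) 13); lia.
move=> [x [le_xa sum_x ex _ runx]].
have le_p : \sum_(j in J) x j <= r by rewrite -sum_x [leqRHS](bigID (mem J)) /= leq_addr.
have neJ j : j \in J -> j != z by apply: contraTneq => ->.
have [s0 Js0 /eqP xs0] : exists2 j, j \in J & x j == 0.
  apply/exists_inP; rewrite -[[exists _ in _, _]]negbK negb_exists_in.
  apply/negP => /forall_inP x0.
  move: le_p; rewrite leqNgt; case/negP; apply: (@leq_trans #|J|); first by rewrite cardJ; lia.
  by rewrite -sum1_card; apply: leq_sum => j Jj; rewrite lt0n x0.
have x_le1 i : i != z -> x i <= 1.
  move=> ne; rewrite leqNgt; apply/negP => x_gt1.
  have ne0 : i != s0 by apply/eqP => eq_i; rewrite eq_i xs0 in x_gt1.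
  have := ex _ _ ne0; have := le_mu _ ne; have := ge_mu _ Js0; have := le_xa i.
  by rewrite xs0; nia.
have hit_ge i j : i != z -> 0 < x i -> x j = 0 -> a j <= a i.
  move=> ne xi xj; have ne' : i != j by apply/eqP => eq_i; rewrite eq_i xj in xi.
  by have := ex _ _ ne'; have := x_le1 _ ne; have := le_xa i; rewrite xj; nia.
have a_gt1 i : i != z -> 0 < x i -> 1 < a i.
  by move=> ne xi; have := hit_ge _ _ ne xi xs0; have := ge_mu _ Js0; lia.
have x_z j : j != z -> x j = 0 -> x z * (a j).+1 <= (a z).+1.
  by move=> ne xj; rewrite eq_sym in ne; have := ex _ _ ne; have := le_xa z; rewrite xj; nia.
(* Cells other than the core lose singletons, which contribute 0; the extra summand [a z] pays for
   the points taken from the core. *)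
have drop : r + (\sum_ib (split_cells a x ib).-1 + (a z - x z)) <= \sum_i (a i).-1 + a z.
  rewrite (sum_split_cells a x predn) -sum_x (bigD1 z) //= [in leqRHS](bigD1 z) //=.
  rewrite [X in _ + (X + _)](bigD1 z) //=.
  have : \sum_(i | i != z) x i + \sum_(i | i != z) ((x i).-1 + (a i - x i).-1)
         <= \sum_(i | i != z) (a i).-1.
    rewrite -big_split; apply: leq_sum => i ne /=.
    have := x_le1 _ ne; have := a_gt1 _ ne; have := le_xa i; lia.
  by have := le_xa z; lia.
pose J' := [set (j, false) | j in J].
have inj_f : injective (fun j : I => (j, false)) by move=> i j [].
have cardJ' : #|J'| = 3 * r by rewrite card_imset.
have zJ' : (z, false) \notin J' by apply/imsetP => -[j Jj [eq_z]]; rewrite eq_z Jj in zJ.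
have sumJ' : \sum_(ib in J') split_cells a x ib = \sum_(j in J) (a j - x j).
  by rewrite big_imset //=; apply: in2W.
have eqP' : \sum_(j in J) (a j - x j) + \sum_(j in J) x j = \sum_(j in J) a j.
  by rewrite -big_split; apply: eq_bigr => j _; rewrite /= subnK.
have bd' : core_bound (3 * r) (\sum_(ib in J') split_cells a x ib) (split_cells a x (z, false)).+1.
  rewrite sumJ' /split_cells /= -subSn //.
  have step_z i : i != z -> 0 < x i -> (a z).+1 <= (x z).+1 * (a i).+1.
    move=> ne xi; have := ex _ _ ne; have := x_le1 _ ne; have := le_xa i; have := le_xa z.
    by nia.
  (* If no tracked block of size [mu - 1] is hit, all remainders have size at least [mu - 1 >= 4],
     so the new mean is at least 4; otherwise only the old mean is known to be. *)
  have [/exists_inP[j Jj /andP[xj lt_j]] | ] :=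
      boolP [exists j in J, (0 < x j) && (a j < mu)].
    have eq_j : a j = mu.-1 by have := ge_mu _ Jj; lia.
    have geP : mu.-1 * (3 * r) <= \sum_(j in J) a j.
      by rewrite mulnC -cardJ -sum_nat_const; apply: leq_sum.
    apply: (core_bound_step_low (s := mu.-1) bd) => //.
    + by rewrite -eq_j; apply: step_z => //; apply: neJ.
    + by lia.
    by apply: leq_trans geP; rewrite leq_mul2r; apply/orP; right; lia.
  rewrite negb_exists_in => /forall_inP no_low.
  have geQ : mu.-1 * (3 * r) <= \sum_(j in J) (a j - x j).
    rewrite mulnC -cardJ -sum_nat_const; apply: leq_sum => j Jj.
    by have := no_low _ Jj; have := x_le1 _ (neJ _ Jj); have := ge_mu _ Jj; lia.
  have [p0 | ] := posnP (\sum_(j in J) x j).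
    move: eqP'; rewrite p0 addn0 => ->; rewrite /core_bound; apply: leq_trans bd.
    by rewrite leq_mul2l leq_subr orbT.
  move=> p_gt0; have [j Jj xj] : exists2 j, j \in J & 0 < x j.
    apply/exists_inP; rewrite -[[exists _ in _, _]]negbK negb_exists_in.
    apply/negP => /forall_inP x0.
    by move: p_gt0; rewrite big1 // => j Jj; have := x0 _ Jj; lia.
  have eq_j : a j = mu.
    by have := no_low _ Jj; rewrite xj /=; have := le_mu _ (neJ _ Jj); lia.
  apply: (core_bound_step (s := mu) bd).
  + by rewrite -eq_j; apply: step_z => //; apply: neJ.
  + by lia.
  + by case: mu mu_gt4 geQ {le_mu ge_mu no_low eq_j leP mu_gt3} => //= m _; rewrite mulSn; lia.
  by apply: leq_trans geQ; rewrite leq_mul2r; apply/orP; right; lia.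
(* The bound [mu] stays while some cell of that size is missed; once all are hit, [mu - 1] serves.
   In both cases the core bound keeps the piece [x z] cut from the core within the new bound. *)
have [mu' [mu'_gt3 le_mu' ge_mu']] : exists mu', [/\ 3 < mu',
    forall ib, ib != (z, false) -> split_cells a x ib <= mu'
    & forall ib, ib \in J' -> mu'.-1 <= split_cells a x ib].
  have [/existsP[i /and3P[ne_i /eqP ai /eqP xi]] | ] :=
      boolP [exists i, [&& i != z, a i == mu & x i == 0]].
    exists mu; split=> [||_ /imsetP[j Jj ->]]; first by lia.
      case=> i' b ne; rewrite /split_cells /=; have [eq_z|ne'] := eqVneq i' z.
        rewrite eq_z in ne *; case: b ne => [_|]; last by rewrite eqxx.
        have := x_z _ ne_i xi; rewrite ai.
        by have := core_bound_full N_gt0 bd leP; rewrite !expnS expn0; nia.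
      by have := le_mu _ ne'; have := le_xa i'; case: b {ne}; lia.
    rewrite /split_cells /=; have := x_le1 _ (neJ _ Jj); have := ge_mu _ Jj.
    have := hit_ge j i (neJ _ Jj); rewrite ai xi; lia.
  rewrite negb_exists => /forallP all_hit.
  have hit_mu i : i != z -> a i = mu -> x i = 1.
    move=> ne ai; have := all_hit i; have := x_le1 _ ne; rewrite ne ai eqxx /=; lia.
  exists mu.-1; split=> [||_ /imsetP[j Jj ->]]; first by lia.
    case=> i' b ne; rewrite /split_cells /=; have [eq_z|ne'] := eqVneq i' z.
      rewrite eq_z in ne *; case: b ne => [_|]; last by rewrite eqxx.
      have leP3 : \sum_(j in J) a j <= 3 * r * mu.-1 + r.
        apply: leq_trans (_ : \sum_(j in J) (mu.-1 + x j) <= _); last first.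
          by rewrite big_split /= sum_nat_const cardJ leq_add2l.
        apply: leq_sum => j Jj; have := hit_mu _ (neJ _ Jj); have := le_mu _ (neJ _ Jj); lia.
      have lt_mu2 : (a z).+1 < mu ^ 2.
        apply: (core_bound_third N_gt0 bd mu_gt4).
        by case: mu mu_gt4 leP3 {le_mu ge_mu leP mu_gt3 hit_mu all_hit} => //= m _; nia.
      have := x_z _ (neJ _ Js0) xs0; have := ge_mu _ Js0; move: lt_mu2.
      by rewrite !expnS expn0; nia.
    have := hit_mu _ ne'; have := le_mu _ ne'; have := x_le1 _ ne'; have := le_xa i'.
    by case: b {ne}; lia.
  rewrite /split_cells /=; have := x_le1 _ (neJ _ Jj); have := ge_mu _ Jj; lia.
have := IHk _ _ _ _ _ _ cardJ' zJ' mu'_gt3 le_mu' ge_mu' bd' runx.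
rewrite sum_split_cells_id // => /(_ big_n) le_k.
by rewrite mulnS; move: le_k drop; rewrite {2}/split_cells /=; lia.
Qed.

(** * The first phase: whole blocks leave the core *)

(** Empty labels are allowed because splitting a missed cell creates one. *)
Definition core_and_blocks r m u (I : finType) (a : I -> nat) :=
  exists z, exists J : {set I},
    [/\ #|J| = m, z \notin J, a z = u, forall j, j \in J -> a j = r
      & forall i, i != z -> i \notin J -> a i = 0].

Lemma sum_core_and_blocks (F : nat -> nat) r m u (I : finType) (a : I -> nat) :
  F 0 = 0 -> core_and_blocks r m u a -> \sum_i F (a i) = m * F r + F u.
Proof.
move=> F0 [z [J [cardJ zJ az aJ a0]]].
rewrite (bigD1 z) //= az addnC; congr (_ + _).
rewrite (bigID (mem J)) /= [X in _ + X]big1 ?addn0; last by move=> i /andP[/a0 a0i /a0i ->].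
rewrite -cardJ -sum_nat_const; apply: eq_big => [i | i /andP[_ /aJ ->] //].
by rewrite andbC; case: (boolP (i \in J)) => //= Ji; apply: contraTneq Ji => ->.
Qed.

(** If a block were hit, the core would give at most [r - 1] points, and exchange would yield
    [u <= (r - 1) * (r + 1) + r < r ^ 2 + r]. *)
Lemma core_and_blocks_step r m u (I : finType) (a x : I -> nat) :
  (forall i, x i <= a i) -> \sum_i x i = r -> exchange a x -> r ^ 2 + r <= u ->
  core_and_blocks r m u a -> core_and_blocks r m.+1 (u - r) (split_cells a x).
Proof.
move=> le_xa sum_x ex big_u [z [J [cardJ zJ az aJ a0]]].
have x0 i : i != z -> x i = 0.
  move=> ne; apply/eqP; rewrite -leqn0 leqNgt; apply/negP => xi.
  have Ji : i \in J by apply: contraLR xi => /a0 ai0; have := le_xa i; rewrite ai0 //; lia.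
  have lt_xz : x z < r by rewrite -sum_x (bigD1 z) //= (bigD1 i) //=; lia.
  have := ex _ _ ne; have := le_xa i; rewrite az (aJ _ Ji); move: big_u.
  rewrite !expnS expn0 => big_u le_xi h.
  have h1 : x z * r.+1 <= r.-1 * r.+1 by rewrite leq_mul2r; apply/orP; right; lia.
  have h2 : u - x z <= x i * (u - x z) by rewrite leq_pmull.
  have h3 : (x z).+1 * (r - x i).+1 <= (x z).+1 * r by rewrite leq_mul2l; apply/orP; right; lia.
  by nia.
have xz : x z = r by rewrite -sum_x (bigD1 z) //= big1 ?addn0.
have inj_f : injective (fun j : I => (j, false)) by move=> i j [].
exists (z, false), ((z, true) |: [set (j, false) | j in J]); split.
- rewrite cardsU1 card_imset // cardJ; case: imsetP => [[j _ //]|_]; by rewrite add1n.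
- rewrite !inE /= negb_or xpair_eqE andbF /=; apply/imsetP => -[j Jj [eq_z]].
  by rewrite eq_z Jj in zJ.
- by rewrite /split_cells /= az xz.
- move=> jb; rewrite !inE => /orP[/eqP-> | /imsetP[j Jj ->]]; rewrite /split_cells /= ?xz //.
  by rewrite aJ // x0 ?subn0 //; apply: contraTneq Jj => ->.
case=> i b ne; rewrite !inE negb_or xpair_eqE /split_cells /= => /andP[ne' notJ].
have [eq_z | ne_z] := eqVneq i z.
  by move: ne ne'; rewrite eq_z eqxx; case: (b); rewrite ?eqxx.
rewrite x0 // subn0; case: b ne ne' notJ => // _ _ notJ; apply: a0 => //.
by apply: contraNN notJ => Ji; apply/imsetP; exists i.
Qed.

Lemma run_first_phase r m k j u (I : finType) (a : I -> nat) :
  core_and_blocks r j (u + m * r) a -> r ^ 2 <= u -> run r k a ->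
  k <= m \/ exists (I' : finType) (a' : I' -> nat),
    core_and_blocks r (j + m) u a' /\ run r (k - m) a'.
Proof.
elim: m k j I a => [|m IHm] k j I a state_a big_u.
  by move=> runa; right; exists I, a; move: state_a; rewrite addn0 addn0 subn0.
case: k => [|k]; first by left.
move=> [x [le_xa sum_x ex _ runx]].
have big_u' : r ^ 2 + r <= u + m.+1 * r by rewrite mulSn; lia.
have := core_and_blocks_step le_xa sum_x ex big_u' state_a.
have -> : u + m.+1 * r - r = u + m * r by rewrite mulSn; lia.
move=> state'; case: (IHm _ _ _ _ state' big_u runx) => [le_km | [I' [a' [st' run']]]].
  by left.
by right; exists I', a'; rewrite subSS addnS -addSn.
Qed.

(** * Counting the steps of both phases *)

(** On the left, [m] also counts the steps of the first phase, one per block, and the added 1 is the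
    final step, which [run] omits. *)
Lemma run_second_phase r k m u (I : finType) (a : I -> nat) :
  2 < r -> 3 * r <= m -> r ^ 2 <= u -> u < r ^ 2 + r ->
  core_and_blocks r m u a -> run r k a ->
  5 * r.+1 * (m + k).+1 <= 17 * (m * r + u - 2).
Proof.
move=> r_gt2 le_m le_u lt_u st runa.
have sum_a : \sum_i a i = m * r + u := sum_core_and_blocks (F := id) erefl st.
have big_n : 2 * r < \sum_i a i by rewrite sum_a; nia.
(* [run_balanced] starts at [mu = r] and needs [mu >= 4]; for [r = 3] all cells are already
   small. *)
have [r3 | r_gt3] := leqP r 3.
  have {r_gt2 r3} eq_r : r = 3 by lia.
  subst r; rewrite /= in le_u lt_u le_m.
  have le20 i : a i <= size_cap 6.
    case: st => z [J [_ _ az aJ a0]]; have [->|ne] := eqVneq i z.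
      by rewrite az /size_cap /=; lia.
    by have [/aJ -> | /a0 ->] := boolP (i \in J).
  have := run_small big_n (leqnn 6) le20 runa.
  rewrite (sum_core_and_blocks (F := split_cost) erefl st).
  by rewrite /split_cost /=; case: (leqP u 4); case: (leqP u 13); lia.
case: (st) => z [J [cardJ zJ az aJ a0]].
have /card_geqP[s [uniq_s size_s sub_s]] : 3 * r <= #|J| by rewrite cardJ.
pose J' := [set j in s].
have cardJ' : #|J'| = 3 * r by rewrite cardsE (card_uniqP uniq_s).
have aJ' j : j \in J' -> a j = r by rewrite inE => /sub_s/aJ.
have zJ' : z \notin J' by apply: contraNN zJ; rewrite inE => /sub_s.
have le_r i : i != z -> a i <= r.
  by move=> ne; have [/aJ -> | /a0 -> //] := boolP (i \in J).
have ge_r j : j \in J' -> r.-1 <= a j by move/aJ' ->; rewrite leq_pred.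
have bd : core_bound (3 * r) (\sum_(j in J') a j) (a z).+1.
  rewrite (eq_bigr _ aJ') sum_nat_const cardJ' az /core_bound.
  have -> : 3 * (3 * r * r) ^ 2 + 3 * (3 * r * r) * (3 * r) + 5 * (3 * r) ^ 2 =
            (3 * r) ^ 2 * (3 * (r ^ 2 + r) + 5) by rewrite !expnS !expn0; nia.
  by rewrite [3 * _ ^ 2]mulnC -mulnA leq_mul2l; apply/orP; right; lia.
have r_gt0 : 0 < r by lia.
have := run_balanced r_gt0 big_n cardJ' zJ' r_gt3 le_r ge_r bd runa.
rewrite (sum_core_and_blocks (F := predn) erefl st) az => le_k.
rewrite -(leq_pmul2l r_gt0).
have h1 : r * (5 * r.+1 * (m + k).+1) <=
          5 * r.+1 * (m * r + r + (m * r.-1 + u.-1 + u + 21 + 6 * r)).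
  by have : 5 * r.+1 * (r * k) <= 5 * r.+1 * (m * r.-1 + u.-1 + u + 21 + 6 * r);
    [rewrite leq_mul2l le_k orbT | lia].
apply: leq_trans h1 _.
case: r r_gt3 le_m le_u {lt_u st runa sum_a big_n aJ size_s cardJ' aJ' le_r ge_r bd r_gt0 le_k r_gt2}
  => // q q_gt2; rewrite !expnS expn0 /= => le_m le_u.
(* Each variable is written as its lower bound plus a natural number, which leaves a polynomial
   inequality in [w], [v], [p]. *)
have [w ->] : exists w, u = (q.+1 * (q.+1 * 1)) + w by exists (u - q.+1 * (q.+1 * 1)); lia.
have [v ->] : exists v, m = 3 * q.+1 + v by exists (m - 3 * q.+1); lia.
have [p ->] : exists p, q = p + 3 by exists (q - 3); lia.
nia.
Qed.

Lemma run_bound r n k : 0 < r -> 4 * r ^ 2 <= n -> run r k (fun _ : unit => n) ->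
  5 * r.+1 * k.+1 <= 17 * (n - 2).
Proof.
move=> r_gt0 big_n runn.
have [r2 | r_gt2] := leqP r 2.
  have sum_n F : \sum_(i : unit) F n = F n :> nat by rewrite big_const card_unit /= addn0.
  have le_rn : 4 * r <= n by apply: leq_trans big_n; rewrite leq_mul2l -{1}(expn1 r) leq_pexp2l.
  have : k < \sum_(i : unit) n.-1.
    apply: (run_trivial_bound r_gt0 _ _ runn); first by rewrite (sum_n id); lia.
    by exists tt; lia.
  rewrite (sum_n predn) => lt_k.
  have [eq_r | eq_r] : r = 1 \/ r = 2 by lia.
    by subst r; lia.
  by subst r; rewrite /= in big_n; lia.
have r2n : r ^ 2 <= n by apply: leq_trans big_n; rewrite leq_pmull.
(* The core is stopped between [r ^ 2] and [r ^ 2 + r]; then [4 * r ^ 2 <= n] provides the [3 * r]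
   blocks to be tracked. *)
pose m := (n - r ^ 2) %/ r; pose u := r ^ 2 + (n - r ^ 2) %% r.
have eq_n : n = u + m * r by have := divn_eq (n - r ^ 2) r; rewrite /u /m; lia.
have le_u : r ^ 2 <= u by rewrite leq_addr.
have lt_u : u < r ^ 2 + r by rewrite ltn_add2l ltn_mod.
have le_m : 3 * r <= m.
  by rewrite leq_divRL //; move: big_n; rewrite !expnS expn0; lia.
have st0 : core_and_blocks r 0 (u + m * r) (fun _ : unit => n).
  by exists tt, set0; rewrite cards0 inE -eq_n; split=> // -[]; rewrite ?inE ?eqxx.
case: (run_first_phase st0 le_u runn) => [le_km | [I' [a' [st' run']]]].
  by move: le_m le_u; rewrite eq_n !expnS expn0; nia.
have [le_km | /ltnW lt_mk] := leqP k m.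
  by move: le_m le_u; rewrite eq_n !expnS expn0; nia.
have := run_second_phase r_gt2 le_m le_u lt_u st' run'.
by rewrite subnKC // eq_n [u + _]addnC.
Qed.

(** * Stabilisers of labellings *)

Local Open Scope group_scope.

Section CellStab.

Variable T : finType.

Definition cell_stab (I : eqType) (f : T -> I) : {set {perm T}} :=
  [set s : {perm T} | [forall p, f (s p) == f p]].

Lemma cell_stabP (I : eqType) (f : T -> I) (s : {perm T}) :
  reflect (forall p, f (s p) = f p) (s \in cell_stab f).
Proof. by rewrite inE; apply: 'forall_eqP. Qed.

Lemma cell_stab_group_set (I : eqType) (f : T -> I) : group_set (cell_stab f).
Proof.
apply/group_setP; split=> [|s t /cell_stabP fs /cell_stabP ft].
  by apply/cell_stabP => p; rewrite perm1.
by apply/cell_stabP => p; rewrite permM ft.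
Qed.

Canonical cell_stab_group I f := Group (@cell_stab_group_set I f).

Definition refine (I : eqType) (f : T -> I) (A : {set T}) p := (f p, p \in A).

Lemma tperm_cell_stab (I : eqType) (f : T -> I) p q :
  f p = f q -> tperm p q \in cell_stab f.
Proof. by move=> eq_f; apply/cell_stabP => w; case: tpermP => [->|->|]. Qed.

(** Orbit-stabiliser: transpositions make the orbit of [p] its whole cell, and fixing [p] amounts to
    isolating it. *)
Lemma card_cell_stab_point (I : eqType) (f : T -> I) p :
  #|cell_stab f| = (#|[set q | f q == f p]| * #|cell_stab (refine f [set p])|)%N.
Proof.
rewrite -(card_orbit_stab 'P [group of cell_stab f] p); congr (_ * _)%N.
  apply: eq_card => q; rewrite inE; apply/orbitP/eqP => [[s /cell_stabP fs <-]|eq_f].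
    exact: fs.
  by exists (tperm p q); rewrite ?tperm_cell_stab //= /aperm tpermL.
apply: eq_card => s; rewrite in_setI; apply/andP/cell_stabP.
  move=> [/cell_stabP fs /astab1P /= sp] q; congr (_, _); first exact: fs.
  by rewrite !inE -[X in _ == X]sp /= /aperm (inj_eq perm_inj).
move=> fs; split; first by apply/cell_stabP => q; have [] := fs q.
by apply/astab1P; have [_] := fs p; rewrite !inE eqxx => /eqP.
Qed.

Lemma eq_cell_stab (I I' : eqType) (f : T -> I) (g : T -> I') :
  (forall p q, (f p == f q) = (g p == g q)) -> cell_stab f = cell_stab g.
Proof.
by move=> eq_fg; apply/setP => s; rewrite !inE; apply: eq_forallb => p; rewrite eq_fg.
Qed.

Lemma card_cell_stab_points (I : eqType) (f : T -> I) p q : f p != f q ->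
  #|cell_stab f| = (#|[set w | f w == f p]| * #|[set w | f w == f q]| *
    #|cell_stab (refine (refine f [set p]) [set q])|)%N.
Proof.
move=> ne_f; rewrite (card_cell_stab_point f p) (card_cell_stab_point _ q) mulnA.
congr (_ * _ * _)%N; apply: eq_card => w; rewrite !inE xpair_eqE !inE.
have [eq_w | //] := eqVneq (f w) (f q).
have /negbTE-> : q != p by apply: contraNneq ne_f => ->.
by rewrite eqbF_neg; apply: contraNneq ne_f => <-; rewrite eq_w.
Qed.

Lemma cell_stab_neq1 (I : finType) (f : T -> I) :
  cell_stab f != 1 -> exists p q, p != q /\ f p = f q.
Proof.
have [/injectiveP inj_f /eqP[] | /injectivePn[p [q ne eq_f]] _] := boolP (injectiveb f).
  apply/trivgP/subsetP => s /cell_stabP fs; rewrite inE; apply/eqP/permP => p.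
  by rewrite perm1; apply: inj_f.
by exists p, q.
Qed.

Definition cell_size (I : finType) (f : T -> I) i := #|[set p | f p == i]|.
Definition hit_size (I : finType) (f : T -> I) (A : {set T}) i := #|[set p in A | f p == i]|.

Lemma hit_size_le (I : finType) (f : T -> I) A i : hit_size f A i <= cell_size f i.
Proof. by apply/subset_leq_card/subsetP => p; rewrite !inE => /andP[]. Qed.

Lemma sum_hit_size (I : finType) (f : T -> I) A : (\sum_i hit_size f A i = #|A|)%N.
Proof.
rewrite -sum1_card (partition_big f xpredT) //=; apply: eq_bigr => i _.
by rewrite /hit_size -sum1_card; apply: eq_bigl => p; rewrite inE.
Qed.

Lemma cell_size_refine (I : finType) (f : T -> I) (A : {set T}) :
  cell_size (refine f A) =1 split_cells (cell_size f) (hit_size f A).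
Proof.
case=> i b; rewrite /split_cells /=; case: b.
  by apply: eq_card => p; rewrite !inE xpair_eqE eqb_id andbC.
rewrite /cell_size -(cardsID A [set p | f p == i]).
have -> : hit_size f A i = #|[set p | f p == i] :&: A|.
  by apply: eq_card => p; rewrite !inE andbC.
rewrite addKn; apply: eq_card => p.
by rewrite !inE xpair_eqE eqbF_neg andbC.
Qed.

(* For [B] obtained from [A] by replacing [p] with [q], the two stabilisers have
   the same subgroup fixing [p] and [q], whose indices are the two sides. *)
Lemma exchange_of_min (I : finType) (f : T -> I) (A : {set T}) :
  (forall B : {set T}, #|B| = #|A| ->
     #|cell_stab (refine f A)| <= #|cell_stab (refine f B)|) ->
  exchange (cell_size f) (hit_size f A).
Proof.
move=> minA i j ne_ij.
have [-> // | hit_gt0] := posnP (hit_size f A i).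
have [-> | miss_gt0] := posnP (cell_size f j - hit_size f A j); first by rewrite muln0.
have /card_gt0P[p] := hit_gt0; rewrite inE => /andP[Ap /eqP fp].
have := miss_gt0; rewrite -[(_ - _)%N]/(split_cells (cell_size f) (hit_size f A) (j, false)).
rewrite -cell_size_refine => /card_gt0P[q]; rewrite inE xpair_eqE => /andP[/eqP fq].
rewrite eqbF_neg => Aq.
have ne_pq : p != q by apply: contraNneq Aq => <-.
pose B := q |: A :\ p.
have Bp : p \notin B by rewrite !inE negb_or ne_pq eqxx.
have Bq : q \in B by rewrite !inE eqxx.
have cardB : #|B| = #|A| by rewrite cardsU1 !inE (negbTE Aq) andbF (cardsD1 p A) Ap.
have hitB_i : (hit_size f B i).+1 = hit_size f A i.
  rewrite /hit_size [RHS](cardsD1 p) inE Ap fp eqxx /= add1n; congr _.+1.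
  apply: eq_card => w; rewrite !inE; have [-> | _] := eqVneq w q; last by rewrite -andbA.
  by rewrite fq [j == i]eq_sym (negbTE ne_ij) !andbF.
have hitB_j : hit_size f B j = (hit_size f A j).+1.
  rewrite /hit_size [LHS](cardsD1 q) inE Bq fq eqxx /= add1n; congr _.+1.
  apply: eq_card => w; rewrite !inE; have [-> | nwq] := eqVneq w q.
    by rewrite (negbTE Aq).
  have [-> | //] := eqVneq w p.
  by rewrite fp (negbTE ne_ij) !andbF.
have := minA B cardB.
have neA : refine f A p != refine f A q by rewrite xpair_eqE fp fq (negbTE ne_ij).
have neB : refine f B p != refine f B q by rewrite xpair_eqE fp fq (negbTE ne_ij).
rewrite (card_cell_stab_points neA) (card_cell_stab_points neB).
have -> : cell_stab (refine (refine (refine f B) [set p]) [set q]) =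
          cell_stab (refine (refine (refine f A) [set p]) [set q]).
  apply: eq_cell_stab => v w; rewrite !xpair_eqE !inE.
  have [ep | _] := eqVneq (v == p) (w == p); last by rewrite !andbF.
  have [eq | _] := eqVneq (v == q) (w == q); last by rewrite !andbF.
  rewrite !andbT ep eq; congr (_ && _).
  move: ep eq; have [-> /eqP-> _ | _ _] := eqVneq w p; first by rewrite !eqxx.
  by have [-> /eqP-> | //] := eqVneq w q; rewrite !eqxx.
rewrite leq_pmul2r ?cardG_gt0 //.
rewrite -![#|[set w | refine f _ w == _]|]/(cell_size (refine f _) _) !cell_size_refine.
rewrite /split_cells /= Ap (negbTE Aq) (negbTE Bp) Bq fp fq hitB_j -hitB_i.
by have := hit_size_le f A i; rewrite -hitB_i => lt; rewrite [leqRHS]mulnC -subSn // subSS.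
Qed.

Lemma cell_stab_refine (I : finType) (f : T -> I) (A : {set T}) :
  cell_stab (refine f A) = cell_stab f :&: 'C[A | 'P^*].
Proof.
apply/setP => s; rewrite in_setI; apply/cell_stabP/andP.
  move=> fs; split; first by apply/cell_stabP => p; have [] := fs p.
  apply/astab1P => /=; rewrite /setact /=; apply/setP => q.
  rewrite -{1}(permKV s q) mem_imset; last exact: perm_inj.
  by have [_ /esym] := fs (s^-1 q); rewrite permKV.
move=> [/cell_stabP fs /astab1P /= sA] p; congr (_, _); first exact: fs.
by rewrite -{1}sA /setact /= /aperm mem_imset //; apply: perm_inj.
Qed.

(** Multiplication by [t] matches the even elements of [K] with the odd ones. *)
Lemma card_Alt_half (K : {group {perm T}}) t :
  t \in K -> odd_perm t -> #|K| = (2 * #|'Alt_T :&: K|)%N.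
Proof.
move=> Kt odd_t; rewrite -(cardsID 'Alt_T K) mul2n -addnn setIC; congr (_ + _)%N.
rewrite -(card_rcoset ('Alt_T :&: K) t); apply: eq_card => s.
rewrite mem_rcoset in_setD Alt_even (in_setI _ 'Alt_T) Alt_even.
rewrite odd_permM odd_permV odd_t addbT negbK.
by rewrite groupMr ?groupV.
Qed.

(* As no choice of [B] beats [A], no stabiliser is trivial; so each one contains a
   transposition and its even part has index 2. *)
Lemma min_cell_stab (I : finType) (f : T -> I) (G : {group {perm T}}) (A B : {set T}) :
  G = 'Alt_T :> {set _} \/ G = 'Sym_T :> {set _} ->
  G :&: cell_stab (refine f A) != 1 ->
  #|orbit 'P^* (G :&: cell_stab f) B| <= #|orbit 'P^* (G :&: cell_stab f) A| ->
  #|cell_stab (refine f A)| <= #|cell_stab (refine f B)|.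
Proof.
move=> GE ntA le_orb.
have stabE C : 'C_(G :&: cell_stab f)[C | 'P^*] = G :&: cell_stab (refine f C).
  by rewrite -setIA cell_stab_refine.
have le_stab : #|G :&: cell_stab (refine f A)| <= #|G :&: cell_stab (refine f B)|.
  have := card_orbit_stab 'P^* [group of G :&: cell_stab f] B.
  rewrite -(card_orbit_stab 'P^* [group of G :&: cell_stab f] A) /= !stabE => eq_orb.
  have orb_gt0 : 0 < #|orbit 'P^* (G :&: cell_stab f) A|.
    by apply/card_gt0P; exists A; apply: orbit_refl.
  by rewrite -(leq_pmul2l orb_gt0) -eq_orb leq_mul2r le_orb orbT.
have ntB : G :&: cell_stab (refine f B) != 1.
  by move: ntA; rewrite -!cardG_gt1 => /leq_trans; apply.
case: GE => GE; last by move: le_stab; rewrite GE !(setIidPr (subsetT _)).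
have half C : G :&: cell_stab (refine f C) != 1 ->
    #|cell_stab (refine f C)| = (2 * #|'Alt_T :&: cell_stab (refine f C)|)%N.
  move=> ntC; have : cell_stab (refine f C) != 1.
    by apply: contraNneq ntC => ->; rewrite setIC; apply/eqP/setIidPl/sub1G.
  move=> /cell_stab_neq1[p [q [ne eq_f]]]; apply: card_Alt_half (tperm_cell_stab eq_f) _.
  by rewrite odd_tperm.
by rewrite !half // leq_mul2l -GE le_stab.
Qed.

End CellStab.

(** * From greedy bases to runs *)

(** The subsets in [s1] are already chosen. The last one of [s2] is not counted: that a step leaves
    a nontrivial stabiliser is read off from the greedy condition at the next index. *)
Lemma greedy_run n r (G : {group {perm 'I_n}}) (I : finType) (f : 'I_n -> I)
    (s1 s2 : seq {set 'I_n}) :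
  G = 'Alt_('I_n) :> {set _} \/ G = 'Sym_('I_n) :> {set _} ->
  cell_stab f = 'C([set A in s1] | 'P^*) ->
  (forall i, i < size (s1 ++ s2) ->
     let H := pstab G [set A in take i (s1 ++ s2)] in
     let beta := nth set0 (s1 ++ s2) i in
     [&& H != 1, beta \in rsubsets n r &
         [forall gamma in rsubsets n r,
            #|orbit ('P^*)%act H gamma| <= #|orbit ('P^*)%act H beta|]]) ->
  run r (size s2).-1 (cell_size f).
Proof.
move=> GE; elim: s2 s1 I f => [|A [|B s2] IHs] s1 I f // eq_f greedy.
have /and3P[_ rA /forall_inP maxA] := greedy (size s1) ltac:(by rewrite size_cat /=; lia).
have /and3P[ntA _ _] := greedy (size s1).+1 ltac:(by rewrite size_cat /=; lia).
rewrite -cat_rcons in greedy ntA.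
rewrite -(size_rcons s1 A) take_size_cat // in ntA.
rewrite nth_cat ltnn subnn /= in rA maxA; rewrite take_size_cat // in maxA.
have eq_fA : cell_stab (refine f A) = 'C([set C in rcons s1 A] | 'P^*).
  rewrite cell_stab_refine eq_f setIC -astabU; congr 'C(_ | _).
  by apply/setP => C; rewrite !inE mem_rcons inE.
rewrite /pstab -eq_fA in ntA; rewrite /pstab -eq_f in maxA.
have cardA : #|A| = r by move: rA; rewrite inE => /eqP.
exists (hit_size f A); split.
- exact: hit_size_le.
- by rewrite sum_hit_size.
- apply: exchange_of_min => C cardC; apply: min_cell_stab GE ntA _; apply: maxA.
  by rewrite inE cardC cardA.
- have ntK : cell_stab (refine f A) != 1.
    by apply: contraNneq ntA => ->; rewrite setIC; apply/eqP/setIidPl/sub1G.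
  have [p [q [ne eq_pq]]] := cell_stab_neq1 ntK.
  exists (refine f A p); rewrite -cell_size_refine; apply/card_gt1P; exists p, q.
  by rewrite !inE eqxx -eq_pq eqxx.
by apply: eq_run (cell_size_refine f A) _; apply: IHs eq_fA greedy.
Qed.

Lemma greedy_base_bound n r (G : {group {perm 'I_n}}) (s : seq {set 'I_n}) :
  G = 'Alt_('I_n) :> {set _} \/ G = 'Sym_('I_n) :> {set _} ->
  0 < r -> 4 * r ^ 2 <= n -> greedy_base r G s ->
  5 * r.+1 * size s <= 17 * (n - 2).
Proof.
move=> GE r_gt0 big_n /andP[/forallP greedy _].
have [-> | s_gt0] := posnP (size s); first by rewrite muln0.
have run0 : run r (size s).-1 (cell_size (fun _ : 'I_n => tt)).
  apply: (@greedy_run n r G _ _ [::] s GE) => [|i lt_i]; last exact: (greedy (Ordinal lt_i)).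
  apply/setP => g; rewrite [g \in _](introT (cell_stabP _ _)) //; apply/esym/astabP => A.
  by rewrite inE.
rewrite -(prednK s_gt0); apply: run_bound big_n _ => //; apply: eq_run run0 => -[].
by rewrite /cell_size -[RHS]card_ord; apply: eq_card => p; rewrite !inE.
Qed.

(** * The lower bound on bases *)

Lemma card_le_uniq_labels n r (B : {set {set 'I_n}}) (D : {set 'I_n}) :
  B \subset rsubsets n r ->
  {in D &, injective (fun p => [set A in B | p \in A])} ->
  2 * #|D| <= #|B| * r.+1 + 2.
Proof.
move=> /subsetP sB; set l := (X in injective X) => inj_l.
have deg_sum : \sum_(p in D) #|l p| <= #|B| * r.
  apply: (@leq_trans (\sum_(p : 'I_n) #|l p|)).
    by rewrite [leqRHS](bigID (mem D)) /= leq_addr.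
  have -> : (\sum_p #|l p| = \sum_(A in B) #|A|)%N.
    rewrite (eq_bigr (fun p => \sum_(A in B | p \in A) 1)%N); last first.
      by move=> p _; rewrite -sum1_card; apply: eq_bigl => A; rewrite inE.
    rewrite (exchange_big_dep (mem B)) /=; last by move=> p A _ /andP[].
    by apply: eq_bigr => A BA; rewrite -sum1_card; apply: eq_bigl => p; rewrite BA.
  by rewrite -sum_nat_const leq_sum // => A /sB; rewrite inE => /eqP->.
have card0 : #|[set p in D | l p == set0]| <= 1.
  apply/card_le1P => p; rewrite inE => /andP[Dp /eqP lp] q; rewrite !inE.
  apply/andP/eqP => [[Dq /eqP lq]|->]; last by rewrite lp.
  by apply: inj_l => //=; rewrite -/(l q) -/(l p) lp.
have card1 : #|[set p in D | #|l p| == 1%N]| <= #|B|.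
  rewrite -(card_in_imset (f := l)); last first.
    by move=> p q; rewrite !inE => /andP[Dp _] /andP[Dq _]; apply: inj_l.
  rewrite -[leqRHS](card_imset _ (@set1_inj _)); apply: subset_leq_card; apply/subsetP => C.
  case/imsetP=> p; rewrite inE => /andP[_ /cards1P[A eq_A]] ->; rewrite eq_A.
  have : A \in l p by rewrite eq_A inE.
  by rewrite inE => /andP[BA _]; apply: imset_f.
(* For a point in [d] members of [B], [2 <= d + 2 * [d = 0] + [d = 1]]; by injectivity [d = 0]
   occurs at most once and [d = 1] at most [#|B|] times. *)
have : \sum_(p in D) 2 <=
    \sum_(p in D) (#|l p| + ((l p == set0) + (l p == set0) + (#|l p| == 1%N))).
  apply: leq_sum => p _; case: (#|l p|) (cards_eq0 (l p)) => [|[|c]] /=; lia.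
rewrite sum_nat_const !big_split /=.
have sum_card (P : pred 'I_n) : (\sum_(p in D) P p = #|[set p in D | P p]|)%N.
  rewrite -sum1_card big_mkcond [RHS]big_mkcond; apply: eq_bigr => p _.
  by rewrite inE; case: (p \in D) => //=; case: (P p).
rewrite (sum_card (fun p => l p == set0)) (sum_card (fun p => #|l p| == 1%N)).
move=> /leq_trans/(_ (leq_add deg_sum (leq_add (leq_add card0 card0) card1))).
by move: #|D| #|B| => c b; lia.
Qed.

Lemma base_card_bound n r (G : {set {perm 'I_n}}) (B : {set {set 'I_n}}) :
  0 < n -> 'Alt_('I_n) \subset G -> is_base r G B -> 2 * (n - 2) <= #|B| * r.+1.
Proof.
move=> n_gt0 sAG /andP[sB /eqP stab1].
set l := fun p : 'I_n => [set A in B | p \in A].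
have preserve (g : {perm 'I_n}) : ~~ odd_perm g -> (forall p, l (g p) = l p) -> g = 1.
  move=> even_g lg; apply/set1gP; rewrite -stab1 inE (subsetP sAG) ?Alt_even //=.
  apply/astabP => A BA; rewrite /= /setact /=; apply/setP => p.
  rewrite -{1}(permKV g p) mem_imset; last exact: perm_inj.
  by have /setP/(_ A) := lg (g^-1 p); rewrite !inE BA permKV.
have [p0 inj_l] : exists p0, {in [set~ p0] &, injective l}.
  have [/injectiveP inj | /injectivePn[p [q ne_pq eq_pq]]] := boolP (injectiveb l).
    by exists (Ordinal n_gt0) => ? ? _ _; apply: inj.
  exists p => v w; rewrite !inE => ne_v ne_w eq_vw; apply/eqP/negPn/negP => ne_vw.
  (* One transposition is odd and may lie outside [G]; the product of two is even and preserves
     labels, so it must be trivial, yet it moves [p]. *)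
  have g1 : tperm p q * tperm v w = 1.
    apply: preserve; first by rewrite odd_permM !odd_tperm ne_pq ne_vw.
    move=> t; rewrite permM; transitivity (l (tperm p q t)).
      by case: (tpermP v w) => [->|->|].
    by case: tpermP => [->|->|].
  have := congr1 (fun g : {perm 'I_n} => g p) g1; rewrite perm1 permM tpermL.
  case: tpermP => [_ eq|_ eq|_ _ eq].
  - by rewrite eq eqxx in ne_w.
  - by rewrite eq eqxx in ne_v.
  by rewrite eq eqxx in ne_pq.
have := card_le_uniq_labels sB inj_l; rewrite cardsC1 card_ord; lia.
Qed.

Lemma leq_bin n r : 0 < r -> r < n -> n <= 'C(n, r).
Proof.
elim: n r => [|n IHn] [|r] // _; rewrite ltnS binS leq_eqVlt => /orP[/eqP<-|lt_rn].
  by rewrite binn binSn.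
apply: (@leq_trans (n + 1)); first by rewrite addn1.
by rewrite leq_add ?IHn // bin_gt0; lia.
Qed.

Theorem theorem2p10 (r n : nat) (G : {set {perm 'I_n}}) :
  1 <= r -> 4 * r ^ 2 <= n ->
  (G = 'Alt_('I_n))%g \/ (G = 'Sym_('I_n))%g ->
  10 * greedy_max r G <= 17 * base_size r G.
Proof.
move=> r_gt0 big_n GE.
have le_rn : 4 * r <= n by apply: leq_trans big_n; rewrite leq_mul2l -{1}(expn1 r) leq_pexp2l.
have base_bound : 2 * (n - 2) <= base_size r G * r.+1.
  rewrite /base_size; apply: (big_ind (fun m => 2 * (n - 2) <= m * r.+1)).
  (* The default value of the minimum must satisfy the bound too; [n <= 'C(n, r)] is enough. *)
  - have -> : #|rsubsets n r| = 'C(n, r) by rewrite card_draws card_ord.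
    have : n <= 'C(n, r) by apply: leq_bin; lia.
    nia.
  - by move=> u v; case: (leqP u v).
  move=> B /andP[_ baseB]; apply: base_card_bound baseB; first by lia.
  by case: GE => ->; rewrite ?subsetT.
have greedy_bound : 5 * r.+1 * greedy_max r G <= 17 * (n - 2).
  rewrite /greedy_max; apply: (big_ind (fun m => 5 * r.+1 * m <= 17 * (n - 2))).
  - by rewrite muln0.
  - by move=> u v; case: (leqP u v).
  move=> k /existsP[s]; rewrite -[X in _ * X <= _](size_tuple s).
  case: GE => ->.
    exact: (@greedy_base_bound n r [group of 'Alt_('I_n)] s (or_introl erefl)).
  exact: (@greedy_base_bound n r [group of 'Sym_('I_n)] s (or_intror erefl)).
(* Doubling the greedy bound and inserting the base bound leaves a common factor [r + 1] to
   cancel. *)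
by nia.
Qed.
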